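(* Let $\Lambda$ be a commutative discrete valuation ring. Suppose an embedding $X=(A\subset B)$ of $\Lambda$-modules has socle tableau $\Sigma$ and the dual embedding $X^*$ has LR-tableau $\Gamma^*=(\lambda^{(i)})_i$. If $\ell,r\ge1$ are natural numbers and $m=\ell+r$, then the number $\mu_\Sigma(\ell,r)$ of entries $\ell$ in row $r$ of $\Sigma$ is $$\mu_\Sigma(\ell,r)=(\lambda^{(r-1)})'_{m-1}-(\lambda^{(r)})'_m .$$
   Context: Let $p$ be a generator of the maximal ideal of $\Lambda$. All $\Lambda$-modules have finite length. For a partition $\lambda=(\lambda_1\ge\dots\ge\lambda_n\geq 1)$ put $N_\lambda=\Lambda/(p^{\lambda_1})\oplus\cdots\oplus\Lambda/(p^{\lambda_n})$; a $\Lambda$-module $M$ has type $\lambda$ if $M\cong N_\lambda$. $\lambda'$ is the transpose, $\lambda'_i=\#\{j:\lambda_j\ge i\}$. The Young diagram of $\lambda$ has columns of lengths $\lambda_1,\lambda_2,\dots$; rows are numbered from top to bottom, so row $i$ has length $\lambda'_i$. An embedding $(A\subset B)$ consists of a $\Lambda$-module $B$ and a submodule $A$. $\mathrm{soc}^\ell A=\{a\in A:p^\ell a=0\}$. Let $A,B,B/A$ have types $\alpha,\beta,\gamma$. The socle tableau of $(A\subset B)$ is given by the decreasing sequence $(\sigma^{(i)})$, $\sigma^{(i)}$ the type of $B/\mathrm{soc}^iA$; as a filling of $\beta\setminus\gamma$, the boxes of $\sigma^{(\ell-1)}\setminus\sigma^{(\ell)}$ have entry $\ell$. The LR-tableau of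 $(A\subset B)$ is given by the increasing sequence $(\gamma^{(i)})$, $\gamma^{(i)}$ the type of $B/p^iA$ (so $\gamma^{(i)}=\beta$ for $i\ge\alpha_1$); the boxes of $\gamma^{(\ell)}\setminus\gamma^{(\ell-1)}$ have entry $\ell$. Let $E$ be the injective envelope of $\Lambda/(p)$ and $DM=\mathrm{Hom}_\Lambda(M,E)$. With $C=B/A$ and $\pi:B\to C$ canonical, the dual embedding $X^*$ is the inclusion $\mathrm{Hom}_\Lambda(\pi,E):DC\to DB$. Thus $\lambda^{(i)}$ is the type of $DB/p^i DC$ (with $DC$ identified with its image) for all $i\ge0$. *)

(* Defs.v *)
From HB Require Import structures.
From mathcomp Require Import all_boot all_order all_algebra.
From mathcomp Require Import generic_quotient ring_quotient.
From mathcomp Require Import boolp functions.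

Set Implicit Arguments.
Unset Strict Implicit.
Unset Printing Implicit Defensive.

Import GRing.Theory.
Local Open Scope ring_scope.
Local Open Scope quotient_scope.

(* A submodule of V is an element of [submodClosed V] and an ideal of R is a
   submodule of R^o. These are boolean predicates; with the choice axioms of
   [boolp] every Prop-valued submodule is of this form. *)

Section QuotientModule.
Variables (R : pzRingType) (V : lmodType R) (S : submodClosed V).

(* [submodClosed] does not inherit from the [zmodClosed] required by
   [Quotient.quot]; this copy of S carries that structure. *)
Definition zmod_of_submod : {pred V} := fun v => v \in S.

Fact zmod_of_submod_closed : zmod_closed zmod_of_submod.
Proof.
split=> [|u v uS vS]; first exact: rpred0.
by rewrite unfold_in /zmod_of_submod -scaleN1r rpredD ?rpredZ.
Qed.

HB.instance Definition _ :=
  GRing.isZmodClosed.Build V zmod_of_submod zmod_of_submod_closed.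

Definition quotmod : Type := Quotient.quot zmod_of_submod.

HB.instance Definition _ := EqQuotient.on quotmod.
HB.instance Definition _ := GRing.Zmodule.on quotmod.
HB.instance Definition _ := ZmodQuotient.on quotmod.

Definition quot_pi (v : V) : quotmod := \pi v.

Fact quot_piW (P : quotmod -> Prop) :
  (forall v, P (quot_pi v)) -> forall x, P x.
Proof. exact: quotW. Qed.

Fact quot_pi_eq (u v : V) : (quot_pi u == quot_pi v) = (u - v \in S).
Proof. by rewrite -[RHS]/(u - v \in zmod_of_submod) Quotient.idealrBE. Qed.

Fact quot_piD : {morph quot_pi : u v / u + v}.
Proof. by move=> u v; rewrite /quot_pi piE. Qed.

Definition quotmod_scale (a : R) (x : quotmod) : quotmod :=
  quot_pi (a *: repr x).

Fact quotmod_scaleE (a : R) (v : V) :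
  quotmod_scale a (quot_pi v) = quot_pi (a *: v).
Proof.
apply/eqP; rewrite quot_pi_eq -scalerBr rpredZ // -quot_pi_eq.
by rewrite /quot_pi reprK.
Qed.

Fact quotmod_scaleA (a b : R) (x : quotmod) :
  quotmod_scale a (quotmod_scale b x) = quotmod_scale (a * b) x.
Proof. by elim/quot_piW: x => v; rewrite !quotmod_scaleE scalerA. Qed.

Fact quotmod_scale1 : left_id 1 quotmod_scale.
Proof. by elim/quot_piW=> v; rewrite quotmod_scaleE scale1r. Qed.

Fact quotmod_scaleDr : right_distributive quotmod_scale +%R.
Proof.
move=> a; elim/quot_piW=> u; elim/quot_piW=> v.
by rewrite -quot_piD !quotmod_scaleE -quot_piD scalerDr.
Qed.

Fact quotmod_scaleDl (x : quotmod) :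
  {morph quotmod_scale^~ x : a b / a + b}.
Proof.
by elim/quot_piW: x => v a b; rewrite !quotmod_scaleE -quot_piD scalerDl.
Qed.

HB.instance Definition _ := GRing.Zmodule_isLmodule.Build R quotmod
  quotmod_scaleA quotmod_scale1 quotmod_scaleDr quotmod_scaleDl.

Fact quot_pi_is_linear : linear quot_pi.
Proof. by move=> a u v; rewrite quot_piD -quotmod_scaleE. Qed.

HB.instance Definition _ :=
  GRing.isLinear.Build R V quotmod *:%R quot_pi quot_pi_is_linear.

End QuotientModule.

Section Submodules.
Variable R : comPzRingType.

Definition image_sub (U V : lmodType R) (f : {linear U -> V}) : {pred V} :=
  fun v => `[< exists u, v = f u >].

Fact image_sub_closed (U V : lmodType R) (f : {linear U -> V}) :
  subsemimod_closed (image_sub f).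
Proof.
split; first split.
- by apply/asboolP; exists 0; rewrite linear0.
- move=> _ _ /asboolP[u ->] /asboolP[w ->]; apply/asboolP.
  by exists (u + w); rewrite linearD.
- move=> a _ /asboolP[u ->]; apply/asboolP.
  by exists (a *: u); rewrite linearZ.
Qed.

HB.instance Definition _ (U V : lmodType R) (f : {linear U -> V}) :=
  GRing.isSubmodClosed.Build R V (image_sub f) (image_sub_closed f).

(* soc^i A = {a in A | p^i a = 0} *)
Definition soc (p : R) (i : nat) (V : lmodType R) (A : submodClosed V) :
    {pred V} :=
  fun a => (a \in A) && (p ^+ i *: a == 0).

Fact soc_closed (p : R) (i : nat) (V : lmodType R) (A : submodClosed V) :
  subsemimod_closed (soc p i A).
Proof.
split; first split.
- by rewrite unfold_in /soc rpred0 scaler0 eqxx.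
- move=> u v /andP[uA /eqP u0] /andP[vA /eqP v0].
  by rewrite unfold_in /soc rpredD //= scalerDr u0 v0 addr0.
- move=> a u /andP[uA /eqP u0].
  by rewrite unfold_in /soc rpredZ //= scalerA mulrC -scalerA u0 scaler0.
Qed.

HB.instance Definition _ (p : R) (i : nat) (V : lmodType R)
    (A : submodClosed V) :=
  GRing.isSubmodClosed.Build R V (soc p i A) (soc_closed p i A).

(* p^i A *)
Definition powmul (p : R) (i : nat) (V : lmodType R) (A : submodClosed V) :
    {pred V} :=
  fun v => `[< exists2 a, a \in A & v = p ^+ i *: a >].

Fact powmul_closed (p : R) (i : nat) (V : lmodType R) (A : submodClosed V) :
  subsemimod_closed (powmul p i A).
Proof.
split; first split.
- by apply/asboolP; exists 0; rewrite ?rpred0 ?scaler0.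
- move=> _ _ /asboolP[u uA ->] /asboolP[v vA ->]; apply/asboolP.
  by exists (u + v); rewrite ?rpredD ?scalerDr.
- move=> a _ /asboolP[u uA ->]; apply/asboolP.
  by exists (a *: u); rewrite ?rpredZ // !scalerA mulrC.
Qed.

HB.instance Definition _ (p : R) (i : nat) (V : lmodType R)
    (A : submodClosed V) :=
  GRing.isSubmodClosed.Build R V (powmul p i A) (powmul_closed p i A).

Definition principal (a : R) : {pred R^o} :=
  fun x => `[< exists b : R, x = b * a >].

Fact principal_closed (a : R) : subsemimod_closed (principal a).
Proof.
split; first split.
- by apply/asboolP; exists 0; rewrite mul0r.
- move=> _ _ /asboolP[b ->] /asboolP[c ->]; apply/asboolP.
  by exists (b + c); rewrite mulrDl.
- move=> c _ /asboolP[b ->]; apply/asboolP.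
  by exists (c * b); rewrite -mulrA.
Qed.

HB.instance Definition _ (a : R) :=
  GRing.isSubmodClosed.Build R R^o (principal a) (principal_closed a).

End Submodules.

Section DiscreteValuationRing.
Variable R : idomainType.

Definition maximal_ideal (m : submodClosed R^o) : Prop :=
  (1 : R^o) \notin m /\
  forall I : submodClosed R^o,
    {subset m <= I} -> (1 : R^o) \notin I -> I =i m.

(* A local principal ideal domain that is not a field. *)
Definition discrete_valuation_ring : Prop :=
  (forall I : submodClosed R^o, exists a : R, I =i principal a) /\
  exists m : submodClosed R^o,
    [/\ maximal_ideal m,
        forall m' : submodClosed R^o, maximal_ideal m' -> m' =i m
      & exists2 x : R^o, x \in m & x != 0].

End DiscreteValuationRing.

Section ModuleProperties.
Variable R : comPzRingType.

(* The lengths of the strict chains V_0 < V_1 < ... < V_k of submodules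
   are bounded. *)
Definition finite_length (V : lmodType R) : Prop :=
  exists n : nat, forall (k : nat) (U : nat -> submodClosed V),
    (forall i, (i < k)%N ->
       {subset U i <= U i.+1} /\ ~ {subset U i.+1 <= U i}) ->
    (k <= n)%N.

Definition injective_module (E : lmodType R) : Prop :=
  forall (U V : lmodType R) (i : {linear U -> V}) (f : {linear U -> E}),
    injective i -> exists g : {linear V -> E}, forall u, g (i u) = f u.

Definition essential (V E : lmodType R) (i : {linear V -> E}) : Prop :=
  forall U : submodClosed E, (exists2 u, u \in U & u != 0) ->
    exists v, i v \in U /\ i v != 0.

Definition injective_envelope (V E : lmodType R) : Prop :=
  injective_module E /\
  exists i : {linear V -> E}, injective i /\ essential i.

End ModuleProperties.

Section Duality.
Variables (R : comPzRingType) (E : lmodType R).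

Definition linear_pred (V : lmodType R) : pred (V -> E) :=
  fun f => `[< linear f >].

Fact linear_pred_closed (V : lmodType R) :
  subsemimod_closed (@linear_pred V).
Proof.
split; first split.
- by apply/asboolP => a u v; rewrite /= scaler0 addr0.
- move=> f g /asboolP lf /asboolP lg; apply/asboolP => a u v.
  change ((f + g) (a *: u + v)) with (f (a *: u + v) + g (a *: u + v)).
  change (f (a *: u + v) + g (a *: u + v)
          = a *: (f u + g u) + (f v + g v)).
  by rewrite lf lg scalerDr addrACA.
- move=> c f /asboolP lf; apply/asboolP => a u v.
  change (c *: f (a *: u + v) = a *: (c *: f u) + c *: f v).
  by rewrite lf scalerDr !scalerA mulrC.
Qed.

HB.instance Definition _ (V : lmodType R) :=
  GRing.isSubmodClosed.Build R (V -> E) (@linear_pred V)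
    (linear_pred_closed V).

(* D V = Hom_R(V, E), with pointwise operations *)
Record dual (V : lmodType R) := Dual {
  dual_fun :> V -> E;
  dual_funP : linear_pred dual_fun }.

HB.instance Definition _ (V : lmodType R) := [isSub for @dual_fun V].
HB.instance Definition _ (V : lmodType R) := [Choice of dual V by <:].
HB.instance Definition _ (V : lmodType R) :=
  [SubChoice_isSubLmodule of dual V by <:].

Variables (U V : lmodType R) (f : {linear U -> V}).

Fact dual_map_subproof (g : dual V) :
  linear_pred (fun u => g (f u)).
Proof.
have /asboolP lg := dual_funP g.
by apply/asboolP => a u v; rewrite linearP lg.
Qed.

Definition dual_map (g : dual V) : dual U := Dual (dual_map_subproof g).

Fact dual_map_is_linear : linear dual_map.
Proof. by move=> a g h; apply: val_inj. Qed.

HB.instance Definition _ :=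
  GRing.isLinear.Build R (dual V) (dual U) *:%R dual_map dual_map_is_linear.

End Duality.

(* The dual of the embedding A < B: the image of Hom(pi, E) in D B, where
   pi : B -> B/A is the canonical map. *)
Definition dual_embedding (R : comPzRingType) (E B : lmodType R)
    (A : submodClosed B) : submodClosed (dual E B) :=
  image_sub (dual_map (E := E) (@quot_pi R B A)).

Section Types.

Definition is_partition (s : seq nat) : bool := sorted geq s && all (leq 1) s.

Variables (R : comNzRingType) (p : R).

Fixpoint Nmod (s : seq nat) : lmodType R :=
  if s is k :: s' then (quotmod (principal (p ^+ k)) * Nmod s')%type
  else 'rV[R]_0.

Definition has_type (V : lmodType R) (s : seq nat) : Prop :=
  is_partition s /\ exists f : {linear V -> Nmod s}, bijective f.

Variables (B : lmodType R) (A : submodClosed B).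

Definition socle_tableau (sigma : nat -> seq nat) : Prop :=
  forall i, has_type (quotmod (soc p i A)) (sigma i).

Definition LR_tableau (gamma : nat -> seq nat) : Prop :=
  forall i, has_type (quotmod (powmul p i A)) (gamma i).

End Types.

(* The i-th part (i >= 1) of the transpose. *)
Definition transpose (s : seq nat) (i : nat) : nat := count (leq i) s.

(* Rows r >= 1 are numbered from the top, columns j >= 0 from the left;
   column j has length s_j. *)
Definition in_diagram (s : seq nat) (r j : nat) : bool :=
  (1 <= r <= nth 0 s j)%N.

(* The number of boxes in row r of sigma^(l-1) \ sigma^(l). *)
Definition entries_in_row (sigma : nat -> seq nat) (l r : nat) : nat :=
  count (fun j => in_diagram (sigma l.-1) r j && ~~ in_diagram (sigma l) r j)
    (iota 0 (size (sigma l.-1))).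

(* Main.v *)
(* Fix an embedding A < B and put S_l = soc^l A. Since E is injective,
   p^(r+l) DB + p^r DC is the annihilator in DB of
   T_(r,l) = {x in B | p^r x in S_l}, and multiplication by p^r identifies
   T_(r,l) / T_(r,l-1) with (p^r B & S_l) / (p^r B & S_(l-1)). As E contains a
   single copy of R/(p), annihilators preserve lengths, so
     (lambda^(r))'_m = len (p^r B & S_l) - len (p^r B & S_(l-1)).
   On the other side
     (sigma^(l))'_r = len (p^(r-1) B + S_l) - len (p^r B + S_l),
   and len (X + Y) + len (X & Y) = len X + len Y turns
   (sigma^(l-1))'_r - (sigma^(l))'_r into the difference of the lambda-terms. *)
Require Import Defs.
From HB Require Import structures.
From mathcomp Require Import all_boot all_order all_algebra.
From mathcomp Require Import boolp zify.

Set Implicit Arguments.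
Unset Strict Implicit.
Unset Printing Implicit Defensive.

Import GRing.Theory.
Local Open Scope ring_scope.

(** * The lattice of submodules of a module *)

Section SubmoduleLattice.
Variables (R : comPzRingType) (V : lmodType R).
Implicit Types X Y Z : submodClosed V.

(** Funext and proof irrelevance give Leibniz equality, so that lattice identities can be rewritten
    inside [comp] and length functions. *)
Lemma submod_eq X Y : X =i Y -> X = Y.
Proof.
case: X Y => [x [[xD] [xZ]]] [y [[yD] [yZ]]] /= xy.
have {}xy : x = y by apply: funext.
by subst y; rewrite (Prop_irrelevance xD yD) (Prop_irrelevance xZ yZ).
Qed.

Lemma submodB X u v : u \in X -> v \in X -> u - v \in X.
Proof. by move=> uX vX; rewrite -scaleN1r rpredD ?rpredZ. Qed.

Definition fullS : {pred V} := fun=> true.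

Fact fullS_closed : subsemimod_closed fullS.
Proof. by []. Qed.

HB.instance Definition _ := GRing.isSubmodClosed.Build R V fullS fullS_closed.

Definition zeroS : {pred V} := pred1 0.

Fact zeroS_closed : subsemimod_closed zeroS.
Proof.
split; first split; first exact: eqxx.
  by move=> u v /eqP-> /eqP->; rewrite addr0; apply: eqxx.
by move=> a u /eqP->; rewrite scaler0; apply: eqxx.
Qed.

HB.instance Definition _ := GRing.isSubmodClosed.Build R V zeroS zeroS_closed.

Definition capS X Y : {pred V} := fun v => (v \in X) && (v \in Y).

Fact capS_closed X Y : subsemimod_closed (capS X Y).
Proof.
split; first split; first by rewrite unfold_in /capS !rpred0.
  by move=> u v /andP[uX uY] /andP[vX vY]; rewrite unfold_in /capS !rpredD.
by move=> a u /andP[uX uY]; rewrite unfold_in /capS !rpredZ.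
Qed.

HB.instance Definition _ X Y :=
  GRing.isSubmodClosed.Build R V (capS X Y) (capS_closed X Y).

Definition addS X Y : {pred V} :=
  fun v => `[< exists x y, [/\ x \in X, y \in Y & v = x + y] >].

Fact addS_closed X Y : subsemimod_closed (addS X Y).
Proof.
split; first split; first by apply/asboolP; exists 0, 0; rewrite !rpred0 addr0.
  move=> _ _ /asboolP[x [y [xX yY ->]]] /asboolP[x' [y' [x'X y'Y ->]]].
  by apply/asboolP; exists (x + x'), (y + y'); rewrite !rpredD // addrACA.
move=> a _ /asboolP[x [y [xX yY ->]]]; apply/asboolP.
by exists (a *: x), (a *: y); rewrite !rpredZ // scalerDr.
Qed.

HB.instance Definition _ X Y :=
  GRing.isSubmodClosed.Build R V (addS X Y) (addS_closed X Y).

Lemma in_capS X Y v :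
  (v \in (capS X Y : submodClosed V)) = (v \in X) && (v \in Y).
Proof. by []. Qed.

Lemma addSP X Y v :
  reflect (exists x y, [/\ x \in X, y \in Y & v = x + y]) (v \in addS X Y).
Proof. exact: asboolP. Qed.

Lemma capSidl X Y : {subset X <= Y} -> capS X Y = X :> submodClosed V.
Proof.
move=> XY; apply: submod_eq => v; rewrite in_capS.
by apply/andP/idP => [[]//|vX]; split=> //; apply: XY.
Qed.

Lemma capSC X Y : capS X Y = capS Y X :> submodClosed V.
Proof. by apply: submod_eq => v; rewrite !in_capS andbC. Qed.

Lemma addSC X Y : addS X Y = addS Y X :> submodClosed V.
Proof.
by apply: submod_eq => v; apply/addSP/addSP => -[x [y [xX yY ->]]];
  exists y, x; rewrite addrC.
Qed.

Lemma sub_addSl X Y : {subset X <= addS X Y}.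
Proof. by move=> v vX; apply/addSP; exists v, 0; rewrite rpred0 addr0. Qed.

Lemma sub_addSr X Y : {subset Y <= addS X Y}.
Proof. by move=> v vX; apply/addSP; exists 0, v; rewrite rpred0 add0r. Qed.

Lemma addS_sub X Y Z :
  {subset X <= Z} -> {subset Y <= Z} -> {subset addS X Y <= Z}.
Proof.
by move=> XZ YZ _ /addSP[x [y [/XZ xX /YZ yY ->]]]; apply: rpredD.
Qed.

Lemma addSidr X Y : {subset X <= Y} -> addS X Y = Y :> submodClosed V.
Proof.
move=> XY; apply: submod_eq => v; apply/idP/idP; last exact: sub_addSr.
exact: addS_sub.
Qed.

End SubmoduleLattice.
Arguments fullS {R} V.
Arguments zeroS {R} V.

(** * Preimages of submodules under linear maps *)

Section Preimage.
Variables (R : comPzRingType) (V W : lmodType R) (f : {linear V -> W}).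

Definition preS (X : submodClosed W) : {pred V} := fun v => f v \in X.

Fact preS_closed X : subsemimod_closed (preS X).
Proof.
split; first split; first by rewrite unfold_in /preS linear0 rpred0.
  by move=> u v uX vX; rewrite unfold_in /preS linearD rpredD.
by move=> a u uX; rewrite unfold_in /preS linearZ rpredZ.
Qed.

HB.instance Definition _ X :=
  GRing.isSubmodClosed.Build R V (preS X) (preS_closed X).

Lemma in_preS (X : submodClosed W) v :
  (v \in (preS X : submodClosed V)) = (f v \in X).
Proof. by []. Qed.

End Preimage.

(** * Composition series *)

Section CompositionSeries.
Variables (R : comPzRingType) (p : R).

(** Says that every nonzero class modulo [p] is invertible, with explicit witnesses in place of a
    quotient ring. *)
Definition field_modulo : Prop :=
  forall a : R, (exists d, a = d * p) \/ exists c d, c * a = 1 + d * p.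

Hypothesis p_field : field_modulo.

Section Cover.
Variable V : lmodType R.
Implicit Types X Y Z W : submodClosed V.

(* Y / X is isomorphic to R / (p). *)
Definition cover X Y : Prop :=
  {subset X <= Y} /\
  exists y, [/\ y \in Y, y \notin X, p *: y \in X &
    forall z, z \in Y -> exists a, z - a *: y \in X].

(** A composition series from [X] with all factors R/(p). Length is an index of a relation until
    [comp_uniq] shows it is well defined. *)
Inductive comp X : submodClosed V -> nat -> Prop :=
| comp0 : comp X X 0
| compS Y Z n : comp X Y n -> cover Y Z -> comp X Z n.+1.

(** [Y / X] is a line over the field R/(p), so each of its nonzero elements can replace the chosen
    generator. *)
Lemma cover_gen X Y z : cover X Y -> z \in Y -> z \notin X ->
  p *: z \in X /\ forall w, w \in Y -> exists a, w - a *: z \in X.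
Proof.
move=> [XY [y [yY yX pyX yg]]] zY zX.
have [a zaX] := yg z zY; split.
  rewrite -(subrK (a *: y) z) scalerDr rpredD //; first exact: rpredZ.
  by rewrite scalerA mulrC -scalerA rpredZ.
case: (p_field a) => [[d ad]|[c [d cad]]].
  case/negP: zX; rewrite -(subrK (a *: y) z) rpredD //.
  by rewrite ad -scalerA rpredZ.
move=> w wY; have [b wbX] := yg w wY; exists (b * c).
(* Here [c] inverts [a] modulo [p], so [c *: (z - a *: y) + d *: (p *: y)] equals [c *: z - y]. *)
have -> : w - b * c *: z
    = (w - b *: y) - b *: (c *: (z - a *: y) + d *: (p *: y)).
  rewrite (scalerBr c) !scalerA cad scalerDl scale1r opprD addrA subrK.
  by rewrite scalerBr scalerA opprB addrA subrK.
by apply: submodB => //; rewrite rpredZ // rpredD // rpredZ.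
Qed.

Lemma comp_sub X Y n : comp X Y n -> {subset X <= Y}.
Proof. by elim=> [|{}Y Z {}n _ XY [YZ _]] // v /XY/YZ. Qed.

Lemma comp1 X Y : cover X Y -> comp X Y 1.
Proof. exact/compS/comp0. Qed.

Lemma comp_trans X Y Z n k : comp X Y n -> comp Y Z k -> comp X Z (n + k).
Proof.
move=> XY; elim=> [|W Z' {}k _ XW WZ]; first by rewrite addn0.
by rewrite addnS; apply: compS WZ.
Qed.

(** The simple factor survives in exactly one place: in the intersections if [Z] meets [Y] outside
    [X], in the sums otherwise. *)
Lemma cover_cap_add X Y Z : cover X Y ->
  cover (capS X Z) (capS Y Z) /\ addS X Z = addS Y Z :> submodClosed V \/
  capS X Z = capS Y Z :> submodClosed V /\ cover (addS X Z) (addS Y Z).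
Proof.
move=> cXY; have [XY [y [yY yX pyX yg]]] := cXY.
have [[z [zY zZ zX]]|nz] :=
  pselect (exists z, [/\ z \in Y, z \in Z & z \notin X]).
  have [pz zg] := cover_gen cXY zY zX; left; split.
    split; first by move=> v; rewrite !in_capS => /andP[/XY-> ->].
    exists z; rewrite !in_capS zY zZ pz rpredZ // (negPf zX); split=> // w.
    rewrite in_capS => /andP[/zg[a waX] wZ]; exists a.
    by rewrite in_capS waX submodB ?rpredZ.
  apply: submod_eq => v; apply/idP/idP; apply: addS_sub;
    try exact: sub_addSr.
    by move=> u /XY uY; apply: sub_addSl.
  move=> u /zg[a uaX]; apply/addSP; exists (u - a *: z), (a *: z).
  by rewrite rpredZ // subrK.
have YZX v : v \in Y -> v \in Z -> v \in X.
  by move=> vY vZ; apply: contrapT => /negP vX; apply: nz; exists v.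
right; split.
  apply: submod_eq => v; rewrite !in_capS; apply/andP/andP => -[vX vZ].
    by split=> //; apply: XY.
  by split=> //; apply: YZX.
split.
  by apply: addS_sub; [move=> u /XY uY; apply: sub_addSl|apply: sub_addSr].
exists y; split; [exact: sub_addSl| |exact: sub_addSl|].
  apply/negP => /addSP[x [z [xX zZ yxz]]]; case/negP: yX.
  rewrite yxz rpredD // YZX //.
  by rewrite -(addKr x z) addrC -yxz submodB // XY.
move=> _ /addSP[u [z [/yg[a uaX] zZ ->]]]; exists a.
by rewrite addrAC; apply/addSP; exists (u - a *: y), z.
Qed.

Lemma comp_cap_add X Y Z n : comp X Y n ->
  exists a b, [/\ comp (capS X Z) (capS Y Z) a,
    comp (addS X Z) (addS Y Z) b & n = (a + b)%N].
Proof.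
elim=> [|{}Y W {}n _ [a [b [ca cb ->]]] /(cover_cap_add Z)[[c e]|[e c]]].
- by exists 0, 0; split=> //; apply: comp0.
- by exists a.+1, b; rewrite -e; split=> //; apply: compS c.
- by exists a, b.+1; rewrite -e addnS; split=> //; apply: compS c.
Qed.

Lemma comp_ge X Y n : comp X Y n -> {subset Y <= X} -> n = 0.
Proof.
case=> // Z {}Y {}n /comp_sub XZ [_ [y [yY yZ _ _]]] YX.
by case/negP: yZ; apply/XZ/YX.
Qed.

Lemma comp_cover X Y n : cover X Y -> comp X Y n -> n = 1.
Proof.
move=> cXY c; case: c cXY => [[_ [y [yX /negP//]]]|Z {}Y {}n cXZ cZY cXY].
have [_ [y [yY yZ _ _]]] := cZY.
rewrite (comp_ge cXZ) // => z zZ; apply: contrapT => /negP zX.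
case/negP: yZ; have [_] := cover_gen cXY (cZY.1 z zZ) zX.
move=> /(_ y yY)[a yaX]; rewrite -(subrK (a *: z) y) rpredD ?rpredZ //.
exact: (comp_sub cXZ).
Qed.

(** Jordan-Hölder. The second series is cut at the last intermediate term of the first: the part
    below has the length given by induction, the part above lies over a cover and has length 1. *)
Lemma comp_uniq X Y n k : comp X Y n -> comp X Y k -> n = k.
Proof.
move=> cn; elim: cn k => [k /comp_ge->//|{}Y Z {}n cXY IH cYZ k cXZ].
have [a [b [ca cb ->]]] := comp_cap_add Y cXZ.
have XY := comp_sub cXY; have YZ := cYZ.1.
move: ca; rewrite (capSidl XY) (capSC Z) (capSidl YZ) => /IH <-.
move: cb; rewrite (addSidr XY) addSC (addSidr YZ) => /(comp_cover cYZ) ->.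
by rewrite addn1.
Qed.

(** Adding [W] raises the bottom of the series to [W]; intersecting with [Z] then lowers its top to
    [Z]. *)
Lemma comp_between X Y W Z n : comp X Y n ->
  {subset X <= W} -> {subset W <= Z} -> {subset Z <= Y} ->
  exists k, comp W Z k.
Proof.
move=> cXY XW WZ ZY; have [_ [b [_ c _]]] := comp_cap_add W cXY.
have [k [_ [c' _ _]]] := comp_cap_add Z c; exists k.
have WY : {subset W <= Y} by move=> w /WZ/ZY.
move: c'; rewrite (addSidr XW) (capSidl WZ).
by rewrite addSC (addSidr WY) capSC capSidl.
Qed.

Lemma length_function n : comp (zeroS V) (fullS V) n ->
  exists L : submodClosed V -> nat,
  [/\ forall X Y k, comp X Y k -> L Y = (L X + k)%N,
      forall X Y, {subset X <= Y} -> exists k, comp X Y k &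
      forall X Y, (L (capS X Y) + L (addS X Y) = L X + L Y)%N].
Proof.
move=> c0; have sub0 X : {subset zeroS V <= X}.
  by move=> v /eqP->; apply: rpred0.
have ex X Y : {subset X <= Y} -> exists k, comp X Y k.
  by move=> XY; apply: (comp_between c0).
have [L Lc] := choice (fun X => ex (zeroS V) X (sub0 X)).
have Ladd X Y k : comp X Y k -> L Y = (L X + k)%N.
  by move=> c; apply: comp_uniq (Lc Y) _; apply: comp_trans c.
exists L; split=> // X Y.
have [k c] : exists k, comp (capS X Y) X k.
  by apply: ex => v; rewrite in_capS => /andP[].
(* The intersection part is trivial, so X/(X & Y) and (X + Y)/Y have equal length. *)
have [a [b [ca cb kab]]] := comp_cap_add Y c.
have XY : {subset capS X Y <= Y} by move=> v; rewrite in_capS => /andP[].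
move: ca cb kab; rewrite (capSidl XY) (addSidr XY) => /comp_ge->// /Ladd->.
by rewrite add0n (Ladd _ _ _ c) => ->; rewrite addnA addnAC.
Qed.

End Cover.

(** Generators of the factors are lifted through [f], so [f] has to reach only the top [Y]. This
    permits multiplication by a power of [p], which is not onto. *)
Lemma comp_preS (V W : lmodType R) (f : {linear V -> W})
    (X Y : submodClosed W) n :
  (forall y, y \in Y -> exists v, f v = y) -> comp X Y n ->
  comp (preS f X) (preS f Y) n.
Proof.
move=> fY c; elim: c fY => [|{}Y Z {}n _ IH [YZ [z [zZ zY pz zg]]] fZ].
  by move=> _; apply: comp0.
apply: compS (IH _) _ => [y /YZ/fZ //|]; split; first by move=> v /YZ.
have [v fv] := fZ z zZ; exists v; rewrite !in_preS linearZ /= fv; split=> // w.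
by move=> /zg[a waX]; exists a; rewrite in_preS linearB linearZ /= fv.
Qed.

End CompositionSeries.

(** * Modules of a given type *)
Lemma quot_pi0 (R : pzRingType) (V : lmodType R) (S : submodClosed V) v :
  (quot_pi S v == 0) = (v \in S).
Proof. by rewrite -[v in RHS]subr0 -quot_pi_eq linear0. Qed.

Section Powers.
Variables (R : comPzRingType) (p : R).

Lemma powP (V : lmodType R) i v :
  reflect (exists u, v = p ^+ i *: u) (v \in powmul p i (fullS V)).
Proof.
apply: (iffP idP) => [/asboolP[u _ ->]|[u ->]]; first by exists u.
by apply/asboolP; exists u.
Qed.

Definition prodS (V W : lmodType R) (X : submodClosed V) (Y : submodClosed W) :
  submodClosed (V * W)%type := capS (preS fst X) (preS snd Y).

Lemma in_prodS (V W : lmodType R) (X : submodClosed V) (Y : submodClosed W) v :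
  (v \in prodS X Y) = (v.1 \in X) && (v.2 \in Y).
Proof. by []. Qed.

Lemma comp_prodl (V W : lmodType R) (X X' : submodClosed V)
    (Y : submodClosed W) n :
  comp p X X' n -> comp p (prodS X Y) (prodS X' Y) n.
Proof.
elim=> [|{}X' Z {}n _ IH [XZ [z [zZ zX pz zg]]]]; first exact: comp0.
apply: compS IH _; split.
  by move=> v; rewrite !in_prodS => /andP[/XZ-> ->].
exists (z, 0); rewrite !in_prodS /= zZ (negPf zX) pz scaler0 !rpred0.
split=> //.
move=> [u w] /andP[/zg[a uaX] wY]; exists a.
by rewrite in_prodS /= uaX scaler0 subr0.
Qed.

Lemma comp_prodr (V W : lmodType R) (X : submodClosed V)
    (Y Y' : submodClosed W) n :
  comp p Y Y' n -> comp p (prodS X Y) (prodS X Y') n.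
Proof.
elim=> [|{}Y' Z {}n _ IH [YZ [z [zZ zY pz zg]]]]; first exact: comp0.
apply: compS IH _; split.
  by move=> v; rewrite !in_prodS => /andP[-> /YZ].
exists (0, z); rewrite !in_prodS /= zZ (negPf zY) pz scaler0 !rpred0.
split=> //.
move=> [u w] /andP[uX /zg[a waY]]; exists a.
by rewrite in_prodS /= waY scaler0 subr0 andbT.
Qed.

Lemma powmul_prod (V W : lmodType R) i :
  powmul p i (fullS (V * W)%type) =
  prodS (powmul p i (fullS V)) (powmul p i (fullS W)) :> submodClosed _.
Proof.
apply: submod_eq => -[v w]; rewrite in_prodS /=.
apply/powP/andP => [[[v' w'] [-> ->]]|[/powP[v' ->] /powP[w' ->]]].
  by split; apply/powP; [exists v'|exists w'].
by exists (v', w').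
Qed.

End Powers.

Section Types.
Variables (R : idomainType) (p : R).
Hypotheses (p_neq0 : p != 0) (p_proper : forall d, d * p <> 1).

(** The boolean is read as length 0 or 1: for [i < k] the factor is generated by the class of
    [p ^+ i], otherwise both submodules vanish. *)
Lemma comp_cyclic k i : let Q := quotmod (principal (p ^+ k)) in
  comp p (powmul p i.+1 (fullS Q)) (powmul p i (fullS Q)) (i < k).
Proof.
move=> Q; have powD v : p ^+ i.+1 *: (v : Q) = p ^+ i *: (p *: v).
  by rewrite exprSr -scalerA.
have sub : {subset powmul p i.+1 (fullS Q) <= powmul p i (fullS Q)}.
  by move=> v /powP[u ->]; apply/powP; rewrite powD; exists (p *: u).
pose e : Q := quot_pi (principal (p ^+ k)) (1 : R^o).
have eP (v : Q) : exists a : R, v = a *: e.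
  elim/quot_piW: v => a; exists a.
  rewrite -[a *: e]linearZ /=; congr quot_pi.
  by rewrite -[LHS]mulr1.
have [ik|ki] := ltnP i k.
  apply: comp1; split=> //; exists (p ^+ i *: e); split.
  - by apply/powP; exists e.
  - apply/powP => -[v]; have [a ->] := eP v.
    move/eqP; rewrite scalerA -!linearZ /= quot_pi_eq => /asboolP[b].
    rewrite -[_ *: _ - _ *: _]/(p ^+ i * 1 - p ^+ i.+1 * a * 1) !mulr1.
    (* Cancelling [p ^+ i] in [eb] would make [p] a unit with this inverse. *)
    move=> eb; apply: (p_proper (d := a + b * p ^+ (k - i.+1))).
    apply: (mulfI (expf_neq0 i p_neq0)); rewrite mulr1.
    have : p ^+ k = p ^+ i * p ^+ (k - i.+1) * p.
      by rewrite -mulrA -exprSr -exprD -subSn // subSS subnKC // ltnW.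
    move: eb => /(canRL (subrK _)) pi pk.
    rewrite [RHS]pi pk exprSr mulrDl mulrDr addrC !mulrA (mulrC _ b).
    by congr (_ + _); rewrite mulrAC.
  - by apply/powP; exists e; rewrite powD scalerA mulrC -scalerA.
  move=> _ /powP[v ->]; have [a ->] := eP v; exists a.
  by rewrite !scalerA mulrC subrr rpred0.
suff -> : powmul p i (fullS Q) = powmul p i.+1 (fullS Q) :> submodClosed Q.
  exact: comp0.
apply: submod_eq => v; apply/idP/idP => [|/sub//] /powP[u ->].
suff -> : p ^+ i *: u = 0 by apply: rpred0.
have [a ->] := eP u; rewrite scalerA -linearZ /=.
apply/eqP; rewrite quot_pi0; apply/asboolP; exists (p ^+ (i - k) * a).
by rewrite -[LHS]/(p ^+ i * a * 1) mulr1 mulrAC -exprD subnK.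
Qed.

(** Each part greater than [i] contributes one simple factor, and [transpose s i.+1] counts these
    parts. *)
Lemma comp_Nmod s i :
  comp p (powmul p i.+1 (fullS (Nmod p s))) (powmul p i (fullS (Nmod p s)))
    (transpose s i.+1).
Proof.
elim: s => [|k s IH] /=.
  suff -> : powmul p i (fullS 'rV[R]_0) = powmul p i.+1 (fullS 'rV[R]_0)
    :> submodClosed _ by apply: comp0.
  by apply: submod_eq => v; rewrite (thinmx0 v) !rpred0.
rewrite !powmul_prod addnC.
apply: comp_trans (comp_prodl _ (comp_cyclic k i)).
exact: comp_prodr.
Qed.

Lemma Nmod_nilpotent s (x : Nmod p s) : p ^+ sumn s *: x = 0.
Proof.
elim: s x => [|k s IH] /= x; first by rewrite (thinmx0 (_ *: _)).
case: x => u w; congr (_, _); last first.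
  by rewrite exprD -scalerA IH scaler0.
elim/quot_piW: u => a; rewrite -[LHS]/(p ^+ (k + sumn s) *: quot_pi _ a).
rewrite -linearZ; apply/eqP; rewrite quot_pi0.
apply/asboolP; exists (p ^+ sumn s * a).
by rewrite -[LHS]/(p ^+ (k + sumn s) * a) mulrAC -exprD addnC.
Qed.

Variables (V : lmodType R) (S : submodClosed V) (s : seq nat).
Hypothesis Ss : has_type p (quotmod S) s.

(** The map from [V] onto [Nmod p s] with kernel [S] pulls p^j N back to p^j V + S. Transposed parts
    of a type thus become lengths inside [V]. *)
Lemma comp_type i :
  comp p (addS (powmul p i.+1 (fullS V)) S) (addS (powmul p i (fullS V)) S)
    (transpose s i.+1).
Proof.
have [_ [f [g fK gK]]] := Ss.
pose h : {linear V -> Nmod p s} := f \o quot_pi S.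
have h0 v : (h v == 0) = (v \in S).
  by rewrite -quot_pi0 -(can_eq fK) linear0.
have hsurj y : exists v, h v = y.
  rewrite -(gK y); elim/quot_piW: (g y) => v.
  by exists v.
clearbody h; have hpow j : preS h (powmul p j (fullS (Nmod p s))) =
    addS (powmul p j (fullS V)) S :> submodClosed V.
  apply: submod_eq => v; rewrite in_preS; apply/powP/addSP => [[y hv]|].
    have [w hw] := hsurj y; exists (p ^+ j *: w), (v - p ^+ j *: w); split.
    - by apply/powP; exists w.
    - by rewrite -h0 linearB linearZ /= hw hv subrr.
    by rewrite addrC subrK.
  move=> [_ [x [/powP[w ->] xS ->]]]; exists (h w).
  move: xS; rewrite -h0 => /eqP hx.
  by rewrite linearD linearZ /= hx addr0.
by rewrite -!hpow; apply: comp_preS (comp_Nmod _ _).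
Qed.

Lemma comp_full : exists n, comp p S (fullS V) n.
Proof.
have e0 : addS (powmul p 0 (fullS V)) S = fullS V :> submodClosed V.
  apply: submod_eq => v; rewrite [RHS]unfold_in; apply: sub_addSl.
  by apply/powP; exists v; rewrite expr0 scale1r.
have [N eN] : exists N, addS (powmul p N (fullS V)) S = S :> submodClosed V.
  (* The sum of the parts bounds each part, so this power of [p] kills [V / S] and the filtration by
     p^i V + S ends at [S]. *)
  exists (sumn s); apply: submod_eq => v; apply/idP/idP; last exact: sub_addSr.
  apply: addS_sub => // _ /powP[u ->].
  have [_ [f /bij_inj finj]] := Ss.
  rewrite -quot_pi0; apply/eqP/finj.
  by rewrite linearZ linearZ /= Nmod_nilpotent linear0.
suff [n] : exists n, comp p (addS (powmul p N (fullS V)) S)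
    (addS (powmul p 0 (fullS V)) S) n by rewrite eN e0; exists n.
elim: N {eN} => [|N [n IH]]; first by exists 0; apply: comp0.
by exists (transpose s N.+1 + n)%N; apply: comp_trans (comp_type N) IH.
Qed.

End Types.

(** * Duality *)
Lemma quot_lift (R : pzRingType) (V W : lmodType R) (S : submodClosed V)
    (f : {linear V -> W}) :
  (forall v, v \in S -> f v = 0) ->
  exists g : {linear quotmod S -> W}, forall v, g (quot_pi S v) = f v.
Proof.
move=> fS; pose g (x : quotmod S) := f (repr x).
have gE v : g (quot_pi S v) = f v.
  apply/eqP; rewrite -subr_eq0 -linearB fS //.
  by rewrite -quot_pi_eq /quot_pi reprK.
have glin : linear g.
  move=> a; elim/quot_piW=> u; elim/quot_piW=> v.
  by rewrite -linearP !gE linearP.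
pose gM := GRing.isLinear.Build _ _ _ _ g glin.
pose G : {linear quotmod S -> W} := HB.pack g gM.
by exists G.
Qed.

(** [f] descends to V/ker h, which embeds in [W]; injectivity of [E] extends it to [W]. *)
Lemma injective_factor (R : comPzRingType) (E V W : lmodType R)
    (h : {linear V -> W}) (f : {linear V -> E}) : injective_module E ->
  (forall v, h v = 0 -> f v = 0) ->
  exists g : {linear W -> E}, forall v, g (h v) = f v.
Proof.
move=> injE hf; pose K : submodClosed V := preS h (zeroS W).
have [v /eqP|hK hKE] := @quot_lift R V W K h; first by [].
have [v /eqP/hf|fK fKE] := @quot_lift R V E K f; first by [].
have hK_inj : injective hK.
  elim/quot_piW=> u; elim/quot_piW=> v; rewrite !hKE => huv.
  apply/eqP; rewrite quot_pi_eq; apply/eqP.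
  by rewrite linearB huv subrr.
have [g gE] := injE _ _ hK fK hK_inj.
by exists g => v; rewrite -hKE gE fKE.
Qed.

Section Perp.
Variables (R : comPzRingType) (E V : lmodType R).
Implicit Types (X Y : submodClosed V) (f g : dual E V).

Fact dual_fun_linear f : linear f.
Proof. by apply/asboolP; apply: dual_funP. Qed.

HB.instance Definition _ f :=
  GRing.isLinear.Build R V E *:%R (dual_fun f) (dual_fun_linear f).

Fact linear_predP (g : {linear V -> E}) : linear_pred g.
Proof. by apply/asboolP; apply: linearP. Qed.

Lemma dualB f g v : (f - g) v = f v - g v. Proof. by []. Qed.
Lemma dualD f g v : (f + g) v = f v + g v. Proof. by []. Qed.
Lemma dualZ a f v : (a *: f) v = a *: f v. Proof. by []. Qed.

Definition perp X : {pred dual E V} :=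
  fun f => `[< forall x, x \in X -> f x = 0 >].

Lemma perpP X f : reflect (forall x, x \in X -> f x = 0) (f \in perp X).
Proof. exact: asboolP. Qed.

Fact perp_closed X : subsemimod_closed (perp X).
Proof.
split; first split; first by apply/perpP.
  by move=> f g /perpP fX /perpP gX; apply/perpP => x xX;
    rewrite dualD fX // gX // addr0.
by move=> a f /perpP fX; apply/perpP => x xX; rewrite dualZ fX // scaler0.
Qed.

HB.instance Definition _ X :=
  GRing.isSubmodClosed.Build R (dual E V) (perp X) (perp_closed X).

End Perp.
Arguments perp {R} E {V} X.

Section Duality.
Variables (R : comNzRingType) (p : R) (E : lmodType R) (e : E).
Hypotheses (p_field : field_modulo p) (injE : injective_module E).
Hypotheses (e_neq0 : e != 0) (pe0 : p *: e = 0).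
Hypothesis soc_e : forall z, p *: z = 0 -> exists a, z = a *: e.
Variable V : lmodType R.
Implicit Types X Y : submodClosed V.

(** The class of [y] has annihilator (p), which kills [e]. Sending it to [e] is therefore well
    defined on the cyclic submodule it generates, and extends to [V / X]. *)
Lemma cover_separating X y : y \notin X -> p *: y \in X ->
  exists f : dual E V, f \in perp E X /\ f y = e.
Proof.
move=> yX pyX; pose ybar := quot_pi X y.
pose h (a : R^o) := (a : R) *: ybar; pose k (a : R^o) := (a : R) *: e.
have hlin : linear h by move=> a u v; rewrite /h scalerDl scalerA.
have klin : linear k by move=> a u v; rewrite /k scalerDl scalerA.
pose hM := GRing.isLinear.Build _ _ _ _ h hlin.
pose kM := GRing.isLinear.Build _ _ _ _ k klin.
pose H : {linear R^o -> quotmod X} := HB.pack h hM.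
pose K : {linear R^o -> E} := HB.pack k kM.
have HK a : H a = 0 -> K a = 0.
  rewrite /= /h /k /ybar -linearZ => /eqP; rewrite quot_pi0 => ayX.
  case: (p_field a) => [[d ->]|[c [d cad]]].
    by rewrite -scalerA pe0 scaler0.
  case/negP: yX; rewrite -[y]scale1r -(addrK (d * p) 1) -cad scalerBl.
  by rewrite -!scalerA; apply: submodB; apply: rpredZ.
have [g gE] := injective_factor injE HK.
exists (Dual (linear_predP (g \o quot_pi X))); split.
  by apply/perpP => x; rewrite -quot_pi0 => /eqP /= ->; apply: linear0.
have := gE (1 : R^o); rewrite /= /h /k !scale1r.
exact.
Qed.

(** Evaluation at [y] embeds the quotient of annihilators into the p-torsion of [E], which is
    spanned by [e]; a separating functional attains [e]. *)
Lemma cover_perp X Y : cover p X Y -> cover p (perp E Y) (perp E X).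
Proof.
move=> [XY [y [yY yX pyX yg]]].
split; first by move=> f /perpP fY; apply/perpP => x /XY/fY.
have [f [/perpP fX fy]] := cover_separating yX pyX.
exists f; split; first exact/perpP.
- by apply/negP => /perpP/(_ y yY)/eqP; rewrite fy (negPf e_neq0).
- apply/perpP => z /yg[a /fX]; rewrite dualZ linearB linearZ /= fy => /eqP.
  by rewrite subr_eq0 => /eqP->; rewrite scalerA mulrC -scalerA pe0 scaler0.
move=> g /perpP gX; have [|a gy] := soc_e (z := g y).
  by rewrite -(gX _ pyX) linearZ.
exists a; apply/perpP => z /yg[b zX]; rewrite dualB dualZ.
have eval (k : dual E V) : (forall x, x \in X -> k x = 0) -> k z = b *: k y.
  by move=> /(_ _ zX) /eqP; rewrite linearB linearZ subr_eq0 => /eqP.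
by rewrite (eval _ fX) (eval _ gX) gy fy !scalerA mulrC subrr.
Qed.

Lemma comp_perp X Y n : comp p X Y n -> comp p (perp E Y) (perp E X) n.
Proof.
elim=> [|{}Y Z {}n _ IH /cover_perp YZ]; first exact: comp0.
(* Annihilators reverse inclusion, so the top step becomes the bottom one. *)
by rewrite -add1n; apply: comp_trans IH; apply: comp1.
Qed.

Variable A : submodClosed V.

(* A functional vanishing on the right-hand submodule factors through
   x |-> (p^(r+l) x, p^r x + A), whose kernel is that submodule. *)
Lemma perp_soc r l :
  addS (powmul p (r + l) (fullS (dual E V))) (powmul p r (dual_embedding E A))
  = perp E (preS ( *:%R (p ^+ r)) (soc p l A)) :> submodClosed _.
Proof.
apply: submod_eq => f; apply/idP/idP.
  apply: addS_sub => {}f.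
    move=> /powP[g ->]; apply/perpP => x /andP[_ /eqP x0].
    by rewrite dualZ -linearZ addnC exprD -scalerA x0 linear0.
  move=> /asboolP[_ /asboolP[g ->] ->]; apply/perpP => x /andP[xA _].
  rewrite dualZ -[_ *: _]/(p ^+ r *: g (quot_pi A x)) -!linearZ /=.
  by move: xA; rewrite -quot_pi0 => /eqP->; rewrite linear0.
move=> /perpP fT; pose h x := (p ^+ (r + l) *: x, quot_pi A (p ^+ r *: x)).
have hlin : linear h.
  move=> a u v; rewrite -[RHS]/(a *: _ + _, a *: _ + _) /= /h.
  rewrite !scalerDr !scalerA !(mulrC _ a) -!scalerA.
  by rewrite [quot_pi A (_ + _)]linearP.
pose hM := GRing.isLinear.Build _ _ _ _ h hlin.
pose H : {linear V -> (V * quotmod A)%type} := HB.pack h hM.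
have Hf x : H x = 0 -> f x = 0.
  move=> [/eqP x0 /eqP]; rewrite quot_pi0 => xA; apply: fT.
  by apply/andP; split=> //; rewrite scalerA -exprD addnC.
have [g gE] := injective_factor injE Hf.
(* The two components of [g] give the summands: f = p^(r+l) g1 + p^r (g2 o pi). *)
pose g1 x := g (x, 0); pose g2 x := g (0, x).
have g1lin : linear g1.
  by move=> a u v; rewrite /g1 -linearP; congr (g (_, _)); rewrite /= scaler0
    addr0.
have g2lin : linear g2.
  by move=> a u v; rewrite /g2 -linearP; congr (g (_, _)); rewrite /= scaler0
    addr0.
have /asboolP g1P := g1lin; have /asboolP g2P := g2lin.
apply/addSP; exists (p ^+ (r + l) *: Dual g1P).
exists (p ^+ r *: dual_map (quot_pi A) (Dual g2P)); split.
- by apply/powP; exists (Dual g1P).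
- apply/asboolP; exists (dual_map (quot_pi A) (Dual g2P)) => //.
  by apply/asboolP; exists (Dual g2P).
apply: val_inj; apply: funext => x /=.
rewrite -[RHS]/(p ^+ (r + l) *: g1 x + p ^+ r *: g2 (quot_pi A x)).
rewrite -gE -!linearZ -linearD; congr (g _); congr (_, _) => /=.
  by rewrite scaler0 addr0.
by rewrite scaler0 add0r linearZ.
Qed.

End Duality.

(** * Tableaux *)
Section Tableaux.

(** In a decreasing sequence the parts at least [r] come first, so row [r] is an initial segment.
    With [r] positive, the default 0 past the end stays outside it. *)
Lemma leq_nth_transpose s r j : sorted geq s -> (0 < r)%N ->
  (r <= nth 0 s j)%N = (j < transpose s r)%N.
Proof.
move=> sorted_s r_gt0; elim: s sorted_s j => [|x s IH] /= xs j.
  by rewrite nth_nil leqNgt r_gt0.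
rewrite -/(transpose s r).
have [rx|xr] := leqP r x.
  by case: j => //= j; rewrite IH // (path_sorted xs).
have s0 : transpose s r = 0.
  apply/eqP; rewrite -leqn0 leqNgt -has_count.
  apply/hasPn => y /(allP (order_path_min (rev_trans leq_trans) xs)) yx.
  by rewrite -ltnNge; apply: leq_ltn_trans xr.
case: j => [|j] /=; first by rewrite s0 leqNgt xr.
by rewrite IH ?(path_sorted xs) // s0.
Qed.

Lemma count_iota_between a b n : (b <= a <= n)%N ->
  count (fun j => (j < a)%N && ~~ (j < b)%N) (iota 0 n) = (a - b)%N.
Proof.
move=> /andP[ba an].
(* Only the middle one of the three blocks is counted. *)
have -> : n = (b + (a - b) + (n - a))%N by rewrite !subnKC.
rewrite !iotaD !count_cat !add0n subnKC //.
rewrite (@eq_in_count _ _ pred0) ?count_pred0; last first.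
  by move=> j; rewrite mem_iota add0n => /andP[_ ->]; rewrite andbF.
rewrite (@eq_in_count _ _ predT) ?count_predT; last first.
  by move=> j; rewrite mem_iota subnKC // => /andP[bj ->]; rewrite -leqNgt.
rewrite (@eq_in_count _ _ pred0) ?count_pred0 ?size_iota ?addn0 //.
by move=> j; rewrite mem_iota => /andP[aj _]; rewrite ltnNge aj.
Qed.

Lemma entries_in_rowE sigma l r :
  is_partition (sigma l.-1) -> is_partition (sigma l) -> (0 < r)%N ->
  (transpose (sigma l) r <= transpose (sigma l.-1) r)%N ->
  entries_in_row sigma l r =
    (transpose (sigma l.-1) r - transpose (sigma l) r)%N.
Proof.
move=> /andP[s1 _] /andP[s2 _] r_gt0 le21.
rewrite -(count_iota_between (n := size (sigma l.-1))).
  by apply: eq_count => j; rewrite /in_diagram r_gt0 /= !leq_nth_transpose.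
by rewrite le21 count_size.
Qed.

End Tableaux.

(** * The uniformizer and the socle of the injective envelope *)

Lemma maximal_field_modulo (R : idomainType) (p : R) :
  maximal_ideal (principal p) -> field_modulo p.
Proof.
move=> [p1 pmax] a.
pose I : submodClosed R^o := addS (principal p) (principal a).
(* If (p) + (a) is the whole ring, a Bézout relation inverts [a] modulo [p]; otherwise maximality
   puts [a] in (p). *)
have [/addSP[_ [_ [/asboolP[b ->] /asboolP[c ->] e1]]]|I1] :=
  boolP ((1 : R^o) \in I).
  right; exists c, (- b).
  by rewrite [X in X + _]e1 mulNr [b * p + _]addrC addrK.
left; apply/asboolP.
have Ip : {subset principal p <= I} by exact: sub_addSl.
rewrite -[`[< _ >]]/((a : R^o) \in (principal p : submodClosed R^o)).
rewrite -(pmax I Ip I1).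
by apply: sub_addSr; apply/asboolP; exists 1; rewrite mul1r.
Qed.

Lemma maximal_proper (R : idomainType) (p d : R) :
  maximal_ideal (principal p) -> d * p <> 1.
Proof. by move=> [/negP p1 _] dp; apply: p1; apply/asboolP; exists d. Qed.

Lemma uniformizer_neq0 (R : idomainType) (p : R) :
  discrete_valuation_ring R -> maximal_ideal (principal p) -> p != 0.
Proof.
move=> [_ [m [_ m_uniq [x xm x0]]]] /m_uniq pm.
move: xm; rewrite -pm => /asboolP[b xb].
by apply: contraNneq x0 => p0; rewrite xb p0 mulr0.
Qed.

(** Take for [e] the image of the class of 1. If z is nonzero and p z = 0, essentiality gives a z =
    b e nonzero; then [a] is invertible modulo [p], and dividing by it expresses z through [e]. *)
Lemma envelope_socle (R : idomainType) (p : R) (E : lmodType R) :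
  maximal_ideal (principal p) -> injective_envelope (quotmod (principal p)) E ->
  exists e : E, [/\ e != 0, p *: e = 0 &
    forall z, p *: z = 0 -> exists a, z = a *: e].
Proof.
move=> pmax [_ [i [i_inj i_ess]]].
pose u : quotmod (principal p) := quot_pi (principal p) (1 : R^o).
have i0 v : (i v == 0) = (v == 0) by rewrite -(inj_eq i_inj) linear0.
have iu a : i (quot_pi (principal p) (a : R^o)) = a *: i u.
  by rewrite -linearZ -linearZ; congr (i (quot_pi _ _)); rewrite -[LHS]mulr1.
exists (i u); split.
- by rewrite i0 quot_pi0; case: pmax.
- apply/eqP; rewrite -iu i0 quot_pi0.
  by apply/asboolP; exists 1; rewrite mul1r.
move=> z pz0; have [->|z0] := eqVneq z 0; first by exists 0; rewrite scale0r.
have zlin : linear (fun a : R^o => (a : R) *: z).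
  by move=> a b c; rewrite scalerDl scalerA.
pose zM := GRing.isLinear.Build _ _ _ _ _ zlin.
pose fz : {linear R^o -> E} := HB.pack (fun a : R^o => (a : R) *: z) zM.
have [|v []] := i_ess (image_sub fz).
  exists z => //; apply/asboolP; exists (1 : R^o).
  by rewrite -[RHS]/(1 *: z) scale1r.
move=> /asboolP[a]; rewrite -[fz a]/((a : R) *: z).
elim/quot_piW: v => b; rewrite iu => bz; rewrite bz.
have [[d ->]|[c [d cad]] _] := maximal_field_modulo pmax a.
  by rewrite -scalerA pz0 scaler0 eqxx.
exists (c * b); rewrite -scalerA bz scalerA cad scalerDl scale1r.
by rewrite -scalerA pz0 scaler0 addr0.
Qed.

(** * Tableau entries as differences of lengths in [B] *)

Section Lengths.
Variables (R : idomainType) (p : R) (E B : lmodType R) (A : submodClosed B).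
Hypotheses (dvrR : discrete_valuation_ring R).
Hypotheses (pmax : maximal_ideal (principal p)).
Variable L : submodClosed B -> nat.
Hypothesis L_comp : forall X Y k, comp p X Y k -> L Y = (L X + k)%N.

Local Notation pB i := (powmul p i (fullS B)).

Lemma length_socle_tableau sigma i r : socle_tableau p A sigma ->
  L (addS (pB r) (soc p i A)) =
    (L (addS (pB r.+1) (soc p i A)) + transpose (sigma i) r.+1)%N.
Proof.
move=> Asigma; apply: L_comp.
have p_proper d := maximal_proper (d := d) pmax.
exact (comp_type (uniformizer_neq0 dvrR pmax) p_proper (Asigma i) r).
Qed.

Hypothesis ex_comp :
  forall X Y : submodClosed B, {subset X <= Y} -> exists k, comp p X Y k.

(** Two series join the same pair of annihilators: one comes from pulling back along p^r and
    dualising, the other from the type of DB/p^r DC. Uniqueness equates their lengths. *)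
Lemma length_dual_tableau lambda r l :
  injective_envelope (quotmod (principal p)) E ->
  LR_tableau p (dual_embedding E A) lambda ->
  L (capS (soc p l.+1 A) (pB r)) =
    (L (capS (soc p l A) (pB r)) + transpose (lambda r) (r + l).+1)%N.
Proof.
move=> envE Alambda; have [e [e0 pe soce]] := envelope_socle pmax envE.
have [injE _] := envE; have p_field := maximal_field_modulo pmax.
have [k ck] : exists k, comp p (capS (soc p l A) (pB r))
    (capS (soc p l.+1 A) (pB r)) k.
  apply: ex_comp => v; rewrite !in_capS => /andP[/andP[vA /eqP v0] ->].
  rewrite andbT; apply/andP; split=> //.
  by rewrite exprS -scalerA v0 scaler0.
rewrite (L_comp ck); congr addn.
(* Intersecting with p^r B leaves the preimage unchanged and puts the submodule inside the image of
   multiplication by p^r, as [comp_preS] requires. *)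
have preE j : preS ( *:%R (p ^+ r)) (capS (soc p j A) (pB r)) =
    preS ( *:%R (p ^+ r)) (soc p j A) :> submodClosed B.
  apply: submod_eq => v; rewrite !in_preS in_capS andb_idr // => _.
  by apply/powP; exists v.
have p_proper d := maximal_proper (d := d) pmax.
have := comp_type (uniformizer_neq0 dvrR pmax) p_proper (Alambda r) (r + l).
rewrite -addnS !perp_soc //; apply: comp_uniq => //.
apply: comp_perp e0 pe soce _ _ _ _ _ => //.
rewrite -!preE; apply: comp_preS ck => y.
by rewrite in_capS => /andP[_ /powP[u ->]]; exists u.
Qed.

End Lengths.

Theorem proposition4p6 (R : idomainType) (p : R) (E B : lmodType R)
    (A : submodClosed B) (sigma lambda : nat -> seq nat) (l r m : nat) :
  discrete_valuation_ring R ->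
  maximal_ideal (principal p) ->
  injective_envelope (quotmod (principal p)) E ->
  finite_length B ->
  socle_tableau p A sigma ->
  LR_tableau p (dual_embedding E A) lambda ->
  (1 <= l)%N -> (1 <= r)%N -> m = (l + r)%N ->
  (entries_in_row sigma l r)%:Z
    = (transpose (lambda r.-1) m.-1)%:Z - (transpose (lambda r) m)%:Z.
Proof.
move=> dvrR pmax envE _ Asigma Alambda.
(* From here [l] and [r] are one less than in the statement, so the row is [r.+1] and the entry is
   [l.+1]. *)
case: l => // {}l _; case: r => // {}r _ ->.
have p_field := maximal_field_modulo pmax.
have p_proper d := maximal_proper (d := d) pmax.
have soc0 : soc p 0 A = zeroS B :> submodClosed B.
  apply: submod_eq => v; rewrite unfold_in /soc expr0 scale1r.
  by rewrite andb_idl // => /eqP->; apply: rpred0.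
(* Since soc^0 A = 0, [sigma 0] is the type of [B] and supplies a composition series of the whole
   module. *)
have [n c0] := comp_full (uniformizer_neq0 dvrR pmax) p_proper (Asigma 0).
rewrite soc0 in c0.
have [L [L_comp ex_comp L_modular]] := length_function p_field c0.
have L_mono (X Y : submodClosed B) : {subset X <= Y} -> (L X <= L Y)%N.
  by move=> /ex_comp[k /L_comp->]; apply: leq_addr.
pose P : submodClosed B := powmul p r (fullS B).
pose Q : submodClosed B := powmul p r.+1 (fullS B).
pose S i : submodClosed B := soc p i A.
have sigmaE i :
    L (addS P (S i)) = (L (addS Q (S i)) + transpose (sigma i) r.+1)%N.
  exact (length_socle_tableau dvrR pmax L_comp i r Asigma).
have lambdaP : L (capS (S l.+1) P) =
    (L (capS (S l) P) + transpose (lambda r) (r + l).+1)%N.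
  exact (length_dual_tableau dvrR pmax L_comp ex_comp r l envE Alambda).
have lambdaQ : L (capS (S l.+1) Q) =
    (L (capS (S l) Q) + transpose (lambda r.+1) (r.+1 + l).+1)%N.
  exact (length_dual_tableau dvrR pmax L_comp ex_comp r.+1 l envE Alambda).
have QP : {subset Q <= P}.
  by move=> v /powP[u ->]; apply/powP; exists (p *: u); rewrite scalerA -exprSr.
have SS : {subset S l <= S l.+1}.
  move=> v /andP[vA /eqP v0]; apply/andP; split=> //.
  by rewrite exprS -scalerA v0 scaler0.
(* Together with [add_le] and modularity this makes the difference of the lambda-terms nonnegative,
   hence the natural-number subtraction in [entries_in_rowE] exact. *)
have cap_le : (L (capS (capS (S l.+1) Q) (capS (S l) P)) <= L (capS (S l) Q))%N.
  by apply: L_mono => v; rewrite !in_capS => /andP[/andP[_ ->] /andP[->]].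
have add_le :
    (L (addS (capS (S l.+1) Q) (capS (S l) P)) <= L (capS (S l.+1) P))%N.
  apply: L_mono; apply: addS_sub => v; rewrite !in_capS.
    by move=> /andP[-> /QP].
  by move=> /andP[/SS-> ->].
have modP i : (L (capS (S i) P) + L (addS P (S i)) = L P + L (S i))%N.
  by rewrite capSC L_modular.
have modQ i : (L (capS (S i) Q) + L (addS Q (S i)) = L Q + L (S i))%N.
  by rewrite capSC L_modular.
have := L_modular (capS (S l.+1) Q) (capS (S l) P).
move: (sigmaE l) (sigmaE l.+1) (modP l) (modP l.+1) (modQ l) (modQ l.+1).
have [[sort1 _] [sort2 _]] := (Asigma l, Asigma l.+1).
move=> *; rewrite entries_in_rowE //=; last by lia.
have -> : (l + r.+1 = (r + l).+1)%N by lia.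
have -> : (l.+1 + r.+1 = (r.+1 + l).+1)%N by lia.
lia.
Qed.
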